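(* Let $\mathfrak J$ be a Jacobi-Jordan algebra over a field $\mathbb K$ of characteristic $0$ and let $(\pi,M)$ be a representation of $\mathfrak J$. Then $${}_zH^2_s(\mathfrak J,M)\simeq \mathrm{Ext}(\mathfrak J,M),$$ the correspondence being the one that sends the class of a symmetric $2$-cocycle $c$ to the equivalence class of the abelian extension $E_c$ of $\mathfrak J$ by $M$.
   Context: A Jacobi-Jordan algebra is a vector space $\mathfrak J$ with a bilinear product $(x,y)\mapsto xy$ such that $xy=yx$ and $x(yz)+y(zx)+z(xy)=0$ for all $x,y,z$. A representation of $\mathfrak J$ on a vector space $M$ is a linear map $\pi:\mathfrak J\to\mathrm{End}(M)$ with $\pi(xy)=-\pi(x)\pi(y)-\pi(y)\pi(x)$; equivalently $M$ is a $\mathfrak J$-module. For a bilinear map $c:\mathfrak J\times\mathfrak J\to M$ put $$d^2c(x,y,z)=\pi(x)c(y,z)+\pi(y)c(x,z)+\pi(z)c(x,y)+c(xy,z)+c(xz,y)+c(yz,x),$$ and for a linear map $f:\mathfrak J\to M$ put $\delta^1f(x,y)=\pi(x)f(y)+\pi(y)f(x)-f(xy)$. Then ${}_zZ^2_s(\mathfrak J,M)$ is the space of symmetric bilinear maps $c:\mathfrak J\times\mathfrak J\to M$ with $d^2c=0$, ${}_zB^2(\mathfrak J,M)=\{\delta^1f: f:\mathfrak J\to M \text{ linear}\}$, and ${}_zH^2_s(\mathfrak J,M)={}_zZ^2_s(\mathfrak J,M)/{}_zB^2(\mathfrak J,M)$. An abelian extension of $\mathfrak J$ by the module $M$ is a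 short exact sequence of Jacobi-Jordan algebras $0\to M\xrightarrow{i}E\xrightarrow{p}\mathfrak J\to0$ with $(i(M))^2=\{0\}$, where as a vector space $E=M\oplus\mathfrak J$, $i$ is the inclusion, $p$ is the projection, and the product is $$(a\oplus x)(b\oplus y)=(\pi(x)b+\pi(y)a+c(x,y))\oplus xy,\qquad a,b\in M,\ x,y\in\mathfrak J,$$ for some bilinear map $c:\mathfrak J\times\mathfrak J\to M$; this algebra is denoted $E_c$. Two abelian extensions $E_c$, $E_{c'}$ are equivalent if there is a Jacobi-Jordan algebra homomorphism $\varphi:E_c\to E_{c'}$ (necessarily an isomorphism) with $\varphi\circ i=i$ and $p\circ\varphi=p$. $\mathrm{Ext}(\mathfrak J,M)$ denotes the set of equivalence classes of abelian extensions of $\mathfrak J$ by $M$. *)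

(* Defs.v *)
From HB Require Import structures.
From mathcomp Require Import all_boot all_algebra.
From mathcomp Require Import generic_quotient ring_quotient sesquilinear.
From mathcomp Require Import boolp functions.

Set Implicit Arguments.
Unset Strict Implicit.
Unset Printing Implicit Defensive.

Import GRing.Theory.
Local Open Scope ring_scope.
Local Open Scope quotient_scope.

(* A Jacobi-Jordan structure is kept separate from its carrier, because many
   different products on the same vector space M * J are considered below. *)
Record jj_algebra (K : fieldType) (V : lmodType K) := JJAlgebra {
  jj_mul :> {bilinear V -> V -> V};
  jj_mulC : forall x y, jj_mul x y = jj_mul y x;
  jj_jacobi : forall x y z,
    jj_mul x (jj_mul y z) + jj_mul y (jj_mul z x) + jj_mul z (jj_mul x y) = 0
}.

Definition jj_morphism (K : fieldType) (U V : lmodType K)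
    (A : jj_algebra U) (B : jj_algebra V) (f : {linear U -> V}) : Prop :=
  forall x y, f (A x y) = B (f x) (f y).

Section ZeroProduct.
Variables (K : fieldType) (V : lmodType K).

Definition zero_mul (x y : V) : V := 0.

Lemma zero_mul_is_bilinear : bilinear_for *:%R *:%R zero_mul.
Proof. by split=> u a v w; rewrite /zero_mul /= scaler0 addr0. Qed.

HB.instance Definition _ :=
  bilinear_isBilinear.Build K V V V *:%R *:%R zero_mul zero_mul_is_bilinear.

Lemma zero_mul_jacobi (x y z : V) :
  zero_mul x (zero_mul y z) + zero_mul y (zero_mul z x)
    + zero_mul z (zero_mul x y) = 0.
Proof. by rewrite /zero_mul !addr0. Qed.

Definition jj_zero : jj_algebra V :=
  @JJAlgebra K V zero_mul (fun _ _ => erefl) zero_mul_jacobi.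

End ZeroProduct.

(* The linear map J -> End(M) is given in curried form, as a bilinear map
   J x M -> M. *)
Record jj_representation (K : fieldType) (J : lmodType K) (A : jj_algebra J)
    (M : lmodType K) := JJRepresentation {
  rep_act :> {bilinear J -> M -> M};
  rep_mul : forall x y m,
    rep_act (A x y) m = - rep_act x (rep_act y m) - rep_act y (rep_act x m)
}.

Section Cohomology.
Variables (K : fieldType) (J : lmodType K) (A : jj_algebra J) (M : lmodType K).
Variable pi : jj_representation A M.

Definition d2 (c : J -> J -> M) (x y z : J) : M :=
  pi x (c y z) + pi y (c x z) + pi z (c x y)
    + c (A x y) z + c (A x z) y + c (A y z) x.

Definition delta1 (f : J -> M) : J -> J -> M :=
  fun x y => pi x (f y) + pi y (f x) - f (A x y).

Definition is_sym_cocycle (c : J -> J -> M) : Prop :=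
  [/\ bilinear_for *:%R *:%R c,
      forall x y, c x y = c y x &
      forall x y z, d2 c x y z = 0].

Definition sym_cocycle : {pred J -> J -> M} := fun c => `[< is_sym_cocycle c >].

Lemma d2P (k : K) (c c' : J -> J -> M) x y z :
  d2 (k *: c + c') x y z = k *: d2 c x y z + d2 c' x y z.
Proof.
have E u v : (k *: c + c') u v = k *: c u v + c' u v by [].
rewrite /d2 !E !linearPr !scalerDr.
set a1 := k *: pi x _; set a2 := k *: pi y _; set a3 := k *: pi z _.
set a4 := k *: c _ z; set a5 := k *: c _ y; set a6 := k *: c _ x.
rewrite (addrACA a1) (addrACA _ _ a3) (addrACA _ _ a4) (addrACA _ _ a5).
by rewrite (addrACA _ _ a6).
Qed.

Lemma sym_cocycle_submod_closed : submod_closed sym_cocycle.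
Proof.
split=> [|k c c' /asboolP[[cl cr] cC c0] /asboolP[[cl' cr'] cC' c0']];
  apply/asboolP; split.
- by split=> u a v w /=; rewrite scaler0 addr0.
- by [].
- by move=> x y z; rewrite /d2 !linear0r !addr0.
- have E x y : (k *: c + c') x y = k *: c x y + c' x y by [].
  by split=> u a v w; rewrite /= !E ?(cl u) ?(cr u) ?(cl' u) ?(cr' u)
    /= !scalerDr !scalerA (mulrC k) addrACA.
- have E x y : (k *: c + c') x y = k *: c x y + c' x y by [].
  by move=> x y; rewrite !E cC cC'.
- by move=> x y z; rewrite d2P c0 c0' scaler0 addr0.
Qed.

HB.instance Definition _ :=
  GRing.isSubmodClosed.Build K (J -> J -> M) sym_cocycle
    sym_cocycle_submod_closed.

Record zZ2s : predArgType := ZZ2s {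
  zZ2s_fun :> J -> J -> M;
  zZ2s_funP : zZ2s_fun \in sym_cocycle
}.

HB.instance Definition _ := [isSub for zZ2s_fun].
HB.instance Definition _ := [Choice of zZ2s by <:].
HB.instance Definition _ := [SubChoice_isSubLmodule of zZ2s by <:].

Lemma delta1_sym_cocycle (f : {linear J -> M}) : delta1 f \in sym_cocycle.
Proof.
have dC x y : delta1 f x y = delta1 f y x.
  by rewrite /delta1 jj_mulC (addrC (pi x _)).
have dr x a v w : delta1 f x (a *: v + w) = a *: delta1 f x v + delta1 f x w.
  rewrite /delta1 (linearPl pi) (linearPr A) !(linearP f) (linearPr pi).
  by rewrite /= scalerBr scalerDr opprD (addrACA (a *: pi x _)) [LHS]addrACA.
apply/asboolP; split=> //.
  by split=> u a v w /=; rewrite ?(dC _ u) dr.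
move=> x y z.
have fJ : f (A (A x y) z) + f (A (A x z) y) + f (A (A y z) x) = 0.
  rewrite -!linearD (jj_mulC A (A x y)) (jj_mulC A (A y z)).
  rewrite (jj_mulC A (A x z)) (jj_mulC A x z).
  by rewrite addrC addrCA addrC jj_jacobi linear0.
rewrite /d2 /delta1 !(linearBr pi) !(linearDr pi) !rep_mul.
rewrite -[RHS]oppr0 -fJ -[LHS]addr0 !opprD -!addrA.
rewrite ?(addrCA _ (pi x (pi y (f z)))) ?(addrCA _ (- pi x (pi y (f z)))) addKr.
rewrite ?(addrCA _ (pi x (pi z (f y)))) ?(addrCA _ (- pi x (pi z (f y)))) addKr.
rewrite ?(addrCA _ (pi x (f (A y z)))) ?(addrCA _ (- pi x (f (A y z)))) addKr.
rewrite ?(addrCA _ (pi y (pi x (f z)))) ?(addrCA _ (- pi y (pi x (f z)))) addKr.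
rewrite ?(addrCA _ (pi y (pi z (f x)))) ?(addrCA _ (- pi y (pi z (f x)))) addKr.
rewrite ?(addrCA _ (pi y (f (A x z)))) ?(addrCA _ (- pi y (f (A x z)))) addKr.
rewrite ?(addrCA _ (pi z (pi x (f y)))) ?(addrCA _ (- pi z (pi x (f y)))) addKr.
rewrite ?(addrCA _ (pi z (pi y (f x)))) ?(addrCA _ (- pi z (pi y (f x)))) addKr.
rewrite ?(addrCA _ (pi z (f (A x y)))) ?(addrCA _ (- pi z (f (A x y)))) addKr.
by rewrite addr0.
Qed.

(* Cut out inside the cocycles; by delta1_sym_cocycle no coboundary is lost. *)
Definition zB2 : {pred zZ2s} :=
  fun c => `[< exists f : {linear J -> M}, zZ2s_fun c = delta1 f >].

Lemma zB2_submod_closed : submod_closed zB2.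
Proof.
split=> [|k c c' /asboolP[f cE] /asboolP[f' cE']]; apply/asboolP.
  exists \0; apply/funext=> x; apply/funext=> y.
  by rewrite /delta1 !linear0r subr0 addr0.
exists (k \*: f \+ f'); apply/funext=> x; apply/funext=> y.
have -> : zZ2s_fun (k *: c + c') x y = k *: c x y + c' x y by [].
rewrite cE cE' /delta1 /= !(linearPr pi) scalerBr scalerDr opprD.
by rewrite (addrACA (k *: pi x _)) [RHS]addrACA.
Qed.

HB.instance Definition _ :=
  GRing.isSubmodClosed.Build K zZ2s zB2 zB2_submod_closed.

Definition zH2s := Quotient.quot zB2.

HB.instance Definition _ := GRing.Zmodule.on zH2s.
HB.instance Definition _ :
  ZmodQuotient zZ2s (Quotient.equiv zB2) 0 -%R +%R zH2s := ZmodQuotient.on zH2s.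

Lemma pi_zH2sD (c c' : zZ2s) :
  \pi_zH2s (c + c') = \pi_zH2s c + \pi_zH2s c' :> zH2s.
Proof. exact: Quotient.pi_add. Qed.

Definition zH2s_scale (k : K) (h : zH2s) : zH2s :=
  \pi_zH2s (k *: repr h).

Lemma pi_zH2s_scale k (c : zZ2s) :
  zH2s_scale k (\pi_zH2s c) = \pi_zH2s (k *: c).
Proof.
apply/eqP; rewrite -Quotient.idealrBE -scalerBr rpredZ //.
by rewrite Quotient.idealrBE reprK.
Qed.

Fact zH2s_scaleA a b h : zH2s_scale a (zH2s_scale b h) = zH2s_scale (a * b) h.
Proof.
rewrite -[h]reprK (pi_zH2s_scale b) (pi_zH2s_scale a) scalerA.
by rewrite -pi_zH2s_scale.
Qed.

Fact zH2s_scale1 : left_id 1 zH2s_scale.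
Proof. by move=> h; rewrite -[h]reprK pi_zH2s_scale scale1r. Qed.

Fact zH2s_scaleDr : right_distributive zH2s_scale +%R.
Proof.
move=> a h h'; rewrite -[h]reprK -[h']reprK -pi_zH2sD.
by rewrite !(pi_zH2s_scale a) -pi_zH2sD scalerDr.
Qed.

Fact zH2s_scaleDl h : {morph zH2s_scale^~ h : a b / a + b}.
Proof.
move=> a b; rewrite -[h]reprK !(pi_zH2s_scale a) (pi_zH2s_scale b).
by rewrite (pi_zH2s_scale (a + b)) -pi_zH2sD scalerDl.
Qed.

HB.instance Definition _ := GRing.Zmodule_isLmodule.Build K zH2s
  zH2s_scaleA zH2s_scale1 zH2s_scaleDr zH2s_scaleDl.

End Cohomology.

Section Extensions.
Variables (K : fieldType) (J : lmodType K) (A : jj_algebra J) (M : lmodType K).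
Variable pi : jj_representation A M.

Definition ext_inj (a : M) : M * J := (a, 0).

Lemma ext_inj_is_linear : linear ext_inj.
Proof. by move=> k a b; congr (_, _); rewrite /= scaler0 addr0. Qed.

HB.instance Definition _ :=
  GRing.isLinear.Build K M (M * J)%type *:%R ext_inj ext_inj_is_linear.

Definition ext_proj (u : M * J) : J := u.2.

Lemma ext_proj_is_linear : linear ext_proj.
Proof. by []. Qed.

HB.instance Definition _ :=
  GRing.isLinear.Build K (M * J)%type J *:%R ext_proj ext_proj_is_linear.

Definition ext_mul (c : J -> J -> M) (u v : M * J) : M * J :=
  (pi u.2 v.1 + pi v.2 u.1 + c u.2 v.2, A u.2 v.2).

(* The map c of ext_mulE is not assumed to be symmetric or a cocycle: both are
   consequences of the Jacobi-Jordan identities of ext_alg. *)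
Record abelian_extension := AbelianExtension {
  ext_alg :> jj_algebra (M * J)%type;
  ext_inj_morph : jj_morphism (jj_zero M) ext_alg ext_inj;
  ext_proj_morph : jj_morphism ext_alg A ext_proj;
  ext_inj_injective : injective ext_inj;
  ext_proj_surjective : forall x, exists u, ext_proj u = x;
  ext_exact : forall u, ext_proj u = 0 <-> exists a, u = ext_inj a;
  ext_sqr0 : forall a b, ext_alg (ext_inj a) (ext_inj b) = 0;
  ext_mulE : exists c : {bilinear J -> J -> M}, ext_alg =2 ext_mul c
}.

Definition ext_equiv (E E' : abelian_extension) : Prop :=
  exists phi : {linear (M * J)%type -> (M * J)%type},
    [/\ jj_morphism E E' phi,
        forall a, phi (ext_inj a) = ext_inj a &
        forall u, ext_proj (phi u) = ext_proj u].

Lemma ext_equiv_refl E : ext_equiv E E.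
Proof. by exists idfun; split. Qed.

Lemma ext_equiv_sym E E' : ext_equiv E E' -> ext_equiv E' E.
Proof.
case=> phi [phiM phi_i p_phi].
have phi_sub u : phi (phi u - u) = phi u - u.
  suff -> : phi u - u = ext_inj (phi u - u).1 by rewrite phi_i.
  apply: injective_projections => //=.
  by rewrite -[(phi u).2]/(ext_proj (phi u)) p_phi subrr.
pose psi : {linear (M * J)%type -> (M * J)%type} := idfun \- (phi \- idfun).
have psiE u : psi u = u - (phi u - u) by [].
have psiK u : psi (phi u) = u.
  by rewrite psiE -linearB /= phi_sub opprB addrC subrK.
have phiK u : phi (psi u) = u.
  by rewrite psiE linearB /= phi_sub opprB addrC subrK.
exists psi; split=> [u v|a|u].
- by rewrite -{1}(phiK u) -{1}(phiK v) -phiM psiK.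
- by rewrite psiE phi_i subrr subr0.
- by rewrite -p_phi phiK.
Qed.

Lemma ext_equiv_trans E E' E'' :
  ext_equiv E E' -> ext_equiv E' E'' -> ext_equiv E E''.
Proof.
case=> [f [fM f_i p_f]] [g [gM g_i p_g]].
exists (g \o f); split=> [u v|a|u] /=; first by rewrite fM gM.
  by rewrite f_i g_i.
by rewrite p_g p_f.
Qed.

HB.instance Definition _ := gen_eqMixin abelian_extension.
HB.instance Definition _ := gen_choiceMixin abelian_extension.

Definition ext_equivb : rel abelian_extension :=
  fun E E' => `[< ext_equiv E E' >].

Lemma ext_equivb_equiv : equiv_class_of ext_equivb.
Proof.
split=> [E|E E'|E' E E''].
- exact/asboolP/ext_equiv_refl.
- by apply/asboolP/asboolP; apply: ext_equiv_sym.
- move=> /asboolP EE' /asboolP E'E''; apply/asboolP.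
  exact: ext_equiv_trans EE' E'E''.
Qed.

Canonical ext_equiv_equiv := EquivRelPack ext_equivb_equiv.
Canonical ext_equiv_encModRel := defaultEncModRel ext_equivb.

Definition Ext := {eq_quot ext_equivb}.

HB.instance Definition _ : EqQuotient abelian_extension ext_equivb Ext :=
  EqQuotient.on Ext.
HB.instance Definition _ := Choice.on Ext.

End Extensions.

(* Main.v *)
Require Import Defs.
From mathcomp Require Import all_boot all_algebra.
From mathcomp Require Import generic_quotient ring_quotient sesquilinear.
From mathcomp Require Import boolp functions.
From HB Require Import structures.
Import GRing.Theory.
Local Open Scope ring_scope.
Local Open Scope quotient_scope.

(** The product of E_c and the cocycle c determine each other. Writing out the
    Jacobi sum of [ext_mul pi c] for a symmetric c, the terms in which the
    representation acts cancel because pi is a representation, and what is left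
    is d2 c in the first component (and the Jacobi sum of J, which is zero, in
    the second). Hence the product is Jacobi-Jordan when c is a symmetric
    2-cocycle, and conversely the map c of an abelian extension, which is
    recovered as the M-part of the product of elements of J, is a symmetric
    2-cocycle: cocycles and abelian extensions are in bijection
    ([ext_of_cocycle], [cocycle_of_ext]).

    A linear map fixing M and inducing the identity on J has the form
    (a, x) |-> (a + f x, x) with f linear, and it is a morphism from E_c to E_c'
    exactly when c - c' = delta1 f ([ext_equivP]). So equivalence of extensions
    corresponds to being cohomologous, and the bijection above passes to the
    quotients. *)

Set Implicit Arguments.
Unset Strict Implicit.
Unset Printing Implicit Defensive.

Section TwistedProduct.
Variables (K : fieldType) (J : lmodType K) (A : jj_algebra J) (M : lmodType K).
Variable pi : jj_representation A M.

Lemma ext_mulC (c : J -> J -> M) : (forall x y, c x y = c y x) ->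
  forall u v, ext_mul pi c u v = ext_mul pi c v u.
Proof.
by move=> cC u v; rewrite /ext_mul cC jj_mulC [pi u.2 _ + _]addrC.
Qed.

Lemma ext_mul_bilinear (c : J -> J -> M) :
  bilinear_for *:%R *:%R c -> bilinear_for *:%R *:%R (ext_mul pi c).
Proof.
move=> [cl cr]; split=> w a u v; congr (_, _) => /=.
- rewrite (cl w.2) (linearPl pi) (linearPr pi) /= !scalerDr.
  by rewrite (addrACA (a *: pi u.2 _)) (addrACA (a *: pi u.2 _ + _)).
- exact: (linearPl A).
- rewrite (cr w.2) (linearPl pi) (linearPr pi) /= !scalerDr.
  by rewrite (addrACA (a *: pi w.2 _)) (addrACA (a *: pi w.2 _ + _)).
- exact: (linearPr A).
Qed.

Lemma ext_mul_right_summand (c : J -> J -> M) x y :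
  (ext_mul pi c (0, x) (0, y)).1 = c x y.
Proof. by rewrite /= !linear0r !add0r. Qed.

(** Each term pi x (pi y b) of the Jacobi sum appears twice with opposite
    signs, once from acting on a product and once from [rep_mul]. *)
Lemma ext_mul_jacobi (c : J -> J -> M) : (forall x y, c x y = c y x) ->
  forall u v w,
    ext_mul pi c u (ext_mul pi c v w) + ext_mul pi c v (ext_mul pi c w u)
      + ext_mul pi c w (ext_mul pi c u v) = (d2 pi c u.2 v.2 w.2, 0).
Proof.
move=> cC [a x] [b y] [e z]; congr (_, _); last exact: jj_jacobi.
rewrite /= /d2 !rep_mul !(linearDr pi) /= (cC z x) (jj_mulC A z x).
rewrite (cC (A x y)) (cC (A x z)) (cC (A y z)).
apply/eqP; rewrite -subr_eq0; apply/eqP; rewrite -[LHS]addr0 !opprD -!addrA.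
(* Each line below brings a summand next to its opposite and cancels them. *)
rewrite ?(addrCA _ (pi x (pi y e))) ?(addrCA _ (- pi x (pi y e))) addKr.
rewrite ?(addrCA _ (pi x (pi z b))) ?(addrCA _ (- pi x (pi z b))) addKr.
rewrite ?(addrCA _ (pi y (pi x e))) ?(addrCA _ (- pi y (pi x e))) addKr.
rewrite ?(addrCA _ (pi y (pi z a))) ?(addrCA _ (- pi y (pi z a))) addKr.
rewrite ?(addrCA _ (pi z (pi x b))) ?(addrCA _ (- pi z (pi x b))) addKr.
rewrite ?(addrCA _ (pi z (pi y a))) ?(addrCA _ (- pi z (pi y a))) addKr.
rewrite ?(addrCA _ (pi x (c y z))) ?(addrCA _ (- pi x (c y z))) addKr.
rewrite ?(addrCA _ (pi y (c x z))) ?(addrCA _ (- pi y (c x z))) addKr.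
rewrite ?(addrCA _ (pi z (c x y))) ?(addrCA _ (- pi z (c x y))) addKr.
rewrite ?(addrCA _ (c x (A y z))) ?(addrCA _ (- c x (A y z))) addKr.
rewrite ?(addrCA _ (c y (A x z))) ?(addrCA _ (- c y (A x z))) addKr.
rewrite ?(addrCA _ (c z (A x y))) ?(addrCA _ (- c z (A x y))) addKr.
by [].
Qed.

Section CocycleToExtension.
Variable c : zZ2s pi.

Lemma zZ2sP : is_sym_cocycle pi c.
Proof. exact/asboolP/zZ2s_funP. Qed.

Lemma zZ2s_bilinear : bilinear_for *:%R *:%R c.
Proof. by case: zZ2sP. Qed.

Lemma zZ2sC x y : c x y = c y x.
Proof. by case: zZ2sP. Qed.

HB.instance Definition _ :=
  bilinear_isBilinear.Build K J J M *:%R *:%R c zZ2s_bilinear.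

HB.instance Definition _ :=
  bilinear_isBilinear.Build K _ _ _ *:%R *:%R (ext_mul pi c)
    (ext_mul_bilinear zZ2s_bilinear).

Lemma ext_mul_cocycle_jacobi u v w :
  ext_mul pi c u (ext_mul pi c v w) + ext_mul pi c v (ext_mul pi c w u)
    + ext_mul pi c w (ext_mul pi c u v) = 0.
Proof. by rewrite (ext_mul_jacobi zZ2sC); case: zZ2sP => _ _ ->. Qed.

Definition ext_alg_of_cocycle : jj_algebra (M * J)%type :=
  @JJAlgebra K (M * J)%type (ext_mul pi c) (ext_mulC zZ2sC)
    ext_mul_cocycle_jacobi.

Lemma ext_mul_inj a b : ext_mul pi c (ext_inj J a) (ext_inj J b) = 0.
Proof. by rewrite /ext_mul /= !linear0l !addr0. Qed.

Lemma ext_of_cocycle_exact (u : M * J) :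
  ext_proj u = 0 <-> exists a, u = ext_inj J a.
Proof.
by split=> [|[a ->] //]; case: u => a x /= ->; exists a.
Qed.

Definition ext_of_cocycle : abelian_extension pi.
Proof.
apply: (@AbelianExtension K J A M pi ext_alg_of_cocycle).
- by move=> a b; rewrite /= ext_mul_inj.
- by [].
- by move=> a b [].
- by move=> x; exists (0, x).
- exact: ext_of_cocycle_exact.
- exact: ext_mul_inj.
- by exists (zZ2s_fun c).
Defined.

End CocycleToExtension.

Section ExtensionToCocycle.
Variable E : abelian_extension pi.

Definition ext_cocycle (x y : J) : M := (E (0, x) (0, y)).1.

Lemma ext_cocycleE : E =2 ext_mul pi ext_cocycle.
Proof.
have [c Ec] := ext_mulE E; have cE x y : ext_cocycle x y = c x y.
  by rewrite /ext_cocycle Ec ext_mul_right_summand.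
by move=> u v; rewrite Ec /ext_mul cE.
Qed.

Lemma ext_cocycle_sym : ext_cocycle \in sym_cocycle pi.
Proof.
have cC x y : ext_cocycle x y = ext_cocycle y x.
  by rewrite /ext_cocycle jj_mulC.
apply/asboolP; split=> //.
  have [c Ec] := ext_mulE E; have cE x y : ext_cocycle x y = c x y.
    by rewrite /ext_cocycle Ec ext_mul_right_summand.
  by split=> w a u v; rewrite !cE ?(linearPl c) ?(linearPr c).
move=> x y z; have := ext_mul_jacobi cC (0, x) (0, y) (0, z).
by rewrite -!ext_cocycleE jj_jacobi => -[].
Qed.

Definition cocycle_of_ext : zZ2s pi := ZZ2s ext_cocycle_sym.

End ExtensionToCocycle.

Lemma ext_of_cocycleK (c : zZ2s pi) : cocycle_of_ext (ext_of_cocycle c) = c.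
Proof.
apply: val_inj; apply/funext=> x; apply/funext=> y.
exact: ext_mul_right_summand.
Qed.

Lemma delta1_morphism (c c' : J -> J -> M) (f : J -> M)
    (phi : M * J -> M * J) :
    (forall u, phi u = (u.1 + f u.2, u.2)) ->
  (forall u v, phi (ext_mul pi c u v) = ext_mul pi c' (phi u) (phi v)) <->
  (forall x y, c x y - c' x y = delta1 pi f x y).
Proof.
move=> phiE; split=> [phiM x y | dE u v].
  have := phiM (0, x) (0, y); rewrite !phiE /ext_mul /= => -[].
  rewrite !linear0r !add0r /delta1 => H.
  by apply/eqP; rewrite subr_eq addrAC eq_sym subr_eq eq_sym H.
rewrite !phiE /ext_mul /=; congr (_, _); rewrite !(linearDr pi).
have /eqP := dE u.2 v.2; rewrite /delta1 subr_eq => /eqP->.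
rewrite -!addrA [c' _ _ + f _]addrC addKr.
by rewrite !(addrCA (pi v.2 u.1)).
Qed.

(** Fixing M and inducing the identity on J leaves for an equivalence only the
    freedom of choosing the M-part f x of the image of (0, x). *)
Lemma ext_equivP (E E' : abelian_extension pi) :
  ext_equiv E E' <-> cocycle_of_ext E - cocycle_of_ext E' \in zB2 (pi := pi).
Proof.
have cBE x y : zZ2s_fun (cocycle_of_ext E - cocycle_of_ext E') x y
             = ext_cocycle E x y - ext_cocycle E' x y by [].
split=> [[phi [phiM phi_i p_phi]] | /asboolP[f fE]].
  pose f x := (phi (0, x)).1.
  have f_lin : linear f.
    move=> k x y; rewrite /f -[RHS]/((k *: phi (0, x) + phi (0, y)).1) -linearP.
    by congr (phi (_, _)).1; rewrite /= scaler0 addr0.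
  pose F : {linear J -> M} :=
    HB.pack f (GRing.isLinear.Build K J M *:%R f f_lin).
  have phiE u : phi u = (u.1 + F u.2, u.2).
    case: u => a x; have -> : (a, x) = ext_inj J a + (0, x).
      by congr (_, _); rewrite /= ?addr0 ?add0r.
    rewrite linearD phi_i; apply: injective_projections => /=.
      by rewrite addr0 add0r.
    by rewrite -[(phi _).2]/(ext_proj (phi _)) p_phi.
  apply/asboolP; exists F; apply/funext=> x; apply/funext=> y; rewrite cBE.
  move: x y; apply/(delta1_morphism _ _ phiE) => u v.
  by rewrite -!ext_cocycleE phiM.
pose phi (u : M * J) : M * J := (u.1 + f u.2, u.2).
have phi_lin : linear phi.
  by move=> k u v; congr (_, _); rewrite /= linearP scalerDr addrACA.
pose Phi : {linear (M * J)%type -> (M * J)%type} :=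
  HB.pack phi (GRing.isLinear.Build K _ _ *:%R phi phi_lin).
exists Phi; split=> [u v|a|//].
  rewrite !ext_cocycleE; move: u v; apply/(@delta1_morphism _ _ f) => // x y.
  by rewrite -cBE fE.
by rewrite /= /phi /= linear0 addr0.
Qed.

Lemma pi_ext_eq (E E' : abelian_extension pi) :
  \pi_(Ext pi) E = \pi_(Ext pi) E' <->
  \pi_(zH2s pi) (cocycle_of_ext E) = \pi_(zH2s pi) (cocycle_of_ext E').
Proof.
split=> [/eqmodP/asboolP/ext_equivP | H].
  by rewrite Quotient.idealrBE => /eqP.
apply/eqmodP/asboolP/ext_equivP.
by rewrite Quotient.idealrBE; apply/eqP.
Qed.

End TwistedProduct.

Theorem theorem2 (K : fieldType) (charK0 : [pchar K] =i pred0)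
    (J : lmodType K) (A : jj_algebra J) (M : lmodType K)
    (pi : jj_representation A M) :
  exists Phi : zH2s pi -> Ext pi,
    bijective Phi /\
    forall c : zZ2s pi, exists E : abelian_extension pi,
      E =2 ext_mul pi c /\ Phi (\pi_(zH2s pi) c) = \pi_(Ext pi) E.
Proof.
pose Phi (h : zH2s pi) : Ext pi := \pi_(Ext pi) (ext_of_cocycle (repr h)).
have Phi_pi c : Phi (\pi_(zH2s pi) c) = \pi_(Ext pi) (ext_of_cocycle c).
  by apply/pi_ext_eq; rewrite !ext_of_cocycleK reprK.
exists Phi; split; last by move=> c; exists (ext_of_cocycle c).
(* One composite is the identity by [ext_of_cocycleK]; for the other, E and the
   extension rebuilt from its cocycle have the same cocycle. *)
exists (fun e => \pi_(zH2s pi) (cocycle_of_ext (repr e))) => [h | e].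
  rewrite -[RHS]reprK -[in RHS](ext_of_cocycleK (repr h)).
  by apply/pi_ext_eq; rewrite reprK.
rewrite Phi_pi -[RHS]reprK; apply/pi_ext_eq.
by rewrite ext_of_cocycleK.
Qed.
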